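(* For any $d\times d$ matrix $\mathbf{B}$, the following are equivalent: (i) $\mathbf{B}\in\mathcal{B}_d$; (ii) there exists a vector $\mathbf{x}$ in $[0,\infty)^{N(\mathbf{B})}$ such that $\mathbf{C}_d\Pi_{\mathbf{B}}\mathbf{x}=\mathbf{p}_d(\mathbf{B})$.
   Context: $\mathcal{B}_d$ is the set of Bernoulli Compatible Matrices: the $d\times d$ matrices expressible as $\mathbb{E}(\mathbf{X}\mathbf{X}^{\mathsf T})$ for some random vector $\mathbf{X}$ taking values in $\{0,1\}^d$. For any $d\times d$ matrix $\mathbf{B}=(b_{ij})$ put $\mathbf{p}_d(\mathbf{B})=(1,b_{1,1},\dots,b_{d,d},b_{1,2},b_{1,3},\dots,b_{d-1,d})^{\mathsf T}$, of length $d(d+1)/2+1$ (the off-diagonal entries $b_{i,j}$, $i<j$, in lexicographic order of $(i,j)$). $\mathbf{C}_d$ is the $(d(d+1)/2+1)\times 2^d$ matrix with $0$-$1$ entries whose columns are indexed by $\mathbf{k}=(k_1,\dots,k_d)\in\{0,1\}^d$ and whose rows are indexed in the same way as the entries of $\mathbf{p}_d$: in column $\mathbf{k}$, the first row has entry $1$; the row corresponding to $b_{i,i}$ has entry $k_i$; the row corresponding to $b_{i,j}$, $i<j$, has entry $k_ik_j$. The columns are ordered by increasing $\sum_j k_j$ and, within equal sums, in reverse lexicographic order. $\mathcal{S}_d$ is the symmetric group on $\{1,\dots,d\}$. For $\sigma\in\mathcal{S}_d$, $\mathbf{P}_\sigma$ is the permutation matrix whose $(i,j)$ entry is $1$ if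 and only if $i=\sigma(j)$. $\mathcal{G}_{\mathbf{B}}=\{\sigma\in\mathcal{S}_d:\mathbf{P}_\sigma\mathbf{B}\mathbf{P}_\sigma^{\mathsf T}=\mathbf{B}\}$, a subgroup of $\mathcal{S}_d$. Identify $\{0,1\}^d$ with the set of functions $\{1,\dots,d\}\to\{0,1\}$; two such functions $g,h$ are equivalent if $g=h\circ\sigma$ for some $\sigma\in\mathcal{G}_{\mathbf{B}}$. $N(\mathbf{B})$ is the number of equivalence classes. $\Pi_{\mathbf{B}}$ is the $2^d\times N(\mathbf{B})$ matrix with rows indexed by $\{0,1\}^d$ (in the same order as the columns of $\mathbf{C}_d$) and columns indexed by the equivalence classes, whose row $\mathbf{i}$ has a $1$ in the column of the class of $\mathbf{i}$ and $0$ elsewhere.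
   Formalization: The matrix B is assumed symmetric; otherwise (ii) ignores the entries below the diagonal and the claim fails, e.g. for d=2, b11=b22=1/2, b12=1/4, b21=0. *)

(* Defs.v *)
From HB Require Import structures.
From mathcomp Require Import all_boot all_order all_fingroup all_algebra.
From mathcomp Require Import all_classical all_reals all_analysis.

Set Implicit Arguments.
Unset Strict Implicit.
Unset Printing Implicit Defensive.

Import Order.TTheory GRing.Theory Num.Theory.

Local Open Scope ring_scope.

Definition bernoulli_compatible (R : realType) (d : nat) (B : 'M[R]_d) : Prop :=
  exists (disp : measure_display) (T : measurableType disp)
         (P : probability T R) (X : 'I_d -> {RV P >-> R}),
    (forall i w, X i w = 0 \/ X i w = 1) /\
    (forall i j, ('E_P[(fun w => X i w * X j w)%R] = (B i j)%:E)%E).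

Definition binvec (d : nat) := {ffun 'I_d -> bool}.

Definition weight d (k : binvec d) : nat := (\sum_(i < d) k i)%N.

(* Increasing weight and, for equal weights, decreasing lexicographic order:
   for d = 2 the order is (0,0), (1,0), (0,1), (1,1). *)
Definition binvec_le d (g h : binvec d) : bool :=
  (weight g < weight h)%N ||
  ((weight g == weight h) && (codom h <= codom g :> seqlexi bool)%O).

Definition binvec_seq d : seq (binvec d) := sort (@binvec_le d) (enum {: binvec d}).

Lemma size_binvec_seq d : size (binvec_seq d) == (2 ^ d)%N.
Proof. by rewrite size_sort -cardE card_ffun card_bool card_ord. Qed.

Definition binvec_tuple d : (2 ^ d)%N.-tuple (binvec d) :=
  Tuple (size_binvec_seq d).

(* Labels of the entries of p_d and of the rows of C_d. *)
Inductive label (d : nat) :=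
  | LOne
  | LDiag of 'I_d
  | LOff of 'I_d & 'I_d.

Arguments LOne {d}.

Definition label_seq d : seq (label d) :=
  LOne :: [seq LDiag i | i <- enum 'I_d] ++
          [seq LOff i j | i : 'I_d <- enum 'I_d, j : 'I_d <- [seq j : 'I_d <- enum 'I_d | (i < j)%N]].

Lemma size_label_seq d : size (label_seq d) == (d * d.+1)./2.+1.
Proof.
rewrite /= eqSS size_cat size_map size_enum_ord size_allpairs_dep.
have -> : sumn [seq size [seq j : 'I_d <- enum 'I_d | (i < j)%N] |
                i : 'I_d <- enum 'I_d] = 'C(d, 2).
  rewrite sumnE big_map big_enum /= -bin2_sum.
  rewrite [RHS]big_mkord (reindex_inj rev_ord_inj) /=; apply: eq_bigr => i _.
  rewrite size_filter -(count_map val (fun m => (rev_ord i < m)%N)) val_enum_ord.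
  rewrite -[X in iota _ X](subnKC (ltn_ord (rev_ord i))) iotaD count_cat.
  rewrite (eq_in_count (a2 := pred0)) => [|m]; last first.
    by rewrite mem_iota add0n ltnS ltnNge => /andP[_ ->].
  rewrite count_pred0 add0n (eq_in_count (a2 := predT)) => [|m]; last first.
    by rewrite mem_iota => /andP[-> _].
  by rewrite count_predT size_iota /= subnSK // subKn // ltnW.
by rewrite addnC -{2}[d]bin1 -binS bin2 mulnC.
Qed.

Definition label_tuple d : (d * d.+1)./2.+1.-tuple (label d) :=
  Tuple (size_label_seq d).

Definition p_vec (R : realType) d (B : 'M[R]_d) : 'cV[R]_((d * d.+1)./2.+1) :=
  \col_r match tnth (label_tuple d) r with
         | LOne => 1
         | LDiag i => B i i
         | LOff i j => B i j
         end.

Definition C_mx (R : realType) d : 'M[R]_((d * d.+1)./2.+1, (2 ^ d)%N) :=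
  \matrix_(r, c)
    let k := tnth (binvec_tuple d) c in
    match tnth (label_tuple d) r with
    | LOne => 1
    | LDiag i => (k i)%:R
    | LOff i j => (k i)%:R * (k j)%:R
    end.

(* This is the transpose of the library's [perm_mx s]. *)
Definition P_mx (R : realType) d (s : 'S_d) : 'M[R]_d :=
  \matrix_(i, j) (i == s j)%:R.

Definition sym_group (R : realType) d (B : 'M[R]_d) : {set 'S_d} :=
  [set s | P_mx R s *m B *m (P_mx R s)^T == B].

Definition binvec_equiv (R : realType) d (B : 'M[R]_d) : rel (binvec d) :=
  fun g h => [exists s in sym_group B, g == [ffun i => h (s i)]].

Lemma sym_groupP (R : realType) d (B : 'M[R]_d) (s : 'S_d) :
  reflect (forall i j, B (s i) (s j) = B i j) (s \in sym_group B).
Proof.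
have PE (M : 'M[R]_d) i j : (P_mx R s *m M *m (P_mx R s)^T) (s i) (s j) = M i j.
  rewrite !mxE (bigD1 j) //= big1 => [|k /negPf kj]; last first.
    by rewrite !mxE (inj_eq perm_inj) eq_sym kj mulr0.
  rewrite !mxE eqxx mulr1 addr0 (bigD1 i) //= big1 => [|k /negPf ki]; last first.
    by rewrite !mxE (inj_eq perm_inj) eq_sym ki mul0r.
  by rewrite !mxE eqxx mul1r addr0.
rewrite inE; apply: (iffP eqP) => [sB i j|sB]; first by rewrite -{1}sB PE.
apply/matrixP => i j.
by rewrite -(permKV s i) -(permKV s j) PE sB.
Qed.

Lemma binvec_equiv_equivalence (R : realType) d (B : 'M[R]_d) :
  equivalence_rel (binvec_equiv B).
Proof.
have refl : reflexive (binvec_equiv B).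
  move=> g; apply/existsP; exists 1%g; apply/andP; split.
    by apply/sym_groupP => i j; rewrite !perm1.
  by apply/eqP/ffunP => i; rewrite ffunE perm1.
have sym : symmetric (binvec_equiv B).
  suff H g h : binvec_equiv B g h -> binvec_equiv B h g.
    by move=> g h; apply/idP/idP; apply: H.
  case/existsP => s /andP[/sym_groupP sB /eqP ->].
  apply/existsP; exists (s^-1)%g; apply/andP; split.
    by apply/sym_groupP => i j; rewrite -sB !permKV.
  by apply/eqP/ffunP => i; rewrite !ffunE permKV.
have trans : transitive (binvec_equiv B).
  move=> h g k /existsP[s /andP[/sym_groupP sB /eqP ->]].
  case/existsP => t /andP[/sym_groupP tB /eqP ->].
  apply/existsP; exists (s * t)%g; apply/andP; split.
    by apply/sym_groupP => i j; rewrite !permM tB sB.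
  by apply/eqP/ffunP => i; rewrite !ffunE permM.
apply/equivalence_relP; split=> // g h gh k.
by apply/idP/idP => [|gk]; [apply: trans; rewrite sym|apply: trans gk].
Qed.

Definition binvec_classes (R : realType) d (B : 'M[R]_d) : {set {set binvec d}} :=
  equivalence_partition (binvec_equiv B) [set: binvec d].

Definition num_classes (R : realType) d (B : 'M[R]_d) : nat :=
  #|binvec_classes B|.

Definition Pi_mx (R : realType) d (B : 'M[R]_d) :
    'M[R]_((2 ^ d)%N, num_classes B) :=
  \matrix_(i, c) (tnth (binvec_tuple d) i \in
                    (enum_val c : {set binvec d}))%:R.

(* Main.v *)
From HB Require Import structures.
Require Import Defs.
From mathcomp Require Import all_boot all_order all_fingroup all_algebra.
From mathcomp Require Import all_classical all_reals all_analysis.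
From mathcomp Require Import measurable_realfun.

Import Order.TTheory GRing.Theory Num.Theory.

Local Open Scope ring_scope.

(** A 0-1 random vector is described by the probabilities [p k] of its [2 ^ d]
possible values, so [B] is compatible exactly when some law [p] on the cube has
the entries of [B] as its moments: [sum_k p k * k i * k j = B i j].  From a random
vector one takes the law of its value ([compatible_represents]); from a law one
takes the coordinate functions on the cube, as a discrete probability space
([represents_compatible]).

Since [k i * k i = k i] and [B] is symmetric, these moment equations together with
[sum_k p k = 1] are exactly the rows of the system [C_mx *m y = p_vec B], where
[y] lists the values of [p] ([C_mx_p_vec]).  A vector [y] of the form
[Pi_mx B *m x] with [x >= 0] is the same thing as a nonnegative function on the
cube that is constant on the classes.  Hence a solution [x] gives a law at once.

Conversely, a law [p] need not be constant on the classes, and the point is that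
it can be made so without changing its moments.  Relabelling the coordinates by
[s] carries the moment matrix [B] to a matrix with entries [B (s i) (s j)] up to
inversion of [s], which is again [B] when [s] is a symmetry of [B].  The moment
conditions are affine in [p], so the average of [p] over all symmetries still
represents [B] ([represents_average]); and averaging over a group gives a
function invariant under it, hence constant on the classes
([average_equiv]). *)

(** * From a random vector to its law *)

(** Whether [B] is compatible depends only on the law of the random vector.
Writing that law as a point-mass function [p] on the finite cube turns the
expectations into finite sums; nonnegativity and total mass 1 say that [p] is a
law. *)
Definition represents {R : realType} {d} (p : binvec d -> R) (B : 'M[R]_d) :=
  [/\ forall k, 0 <= p k, \sum_k p k = 1 &
      forall i j, \sum_k p k * ((k i)%:R * (k j)%:R) = B i j].

(** For a 0-1 random vector this is its value; testing against 1 makes it total. *)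
Definition pattern {T : Type} {R : realType} {d} (X : 'I_d -> T -> R) (w : T) :
  binvec d := [ffun i => X i w == 1].

Lemma measurable_pattern {R : realType} {d disp} {T : measurableType disp}
    (P : probability T R) (X : 'I_d -> {RV P >-> R}) (k : binvec d) :
  measurable [set w | pattern X w = k]%classic.
Proof.
have -> : ([set w | pattern X w = k] =
    \bigcap_(i in [set: 'I_d]) (X i @^-1` [set r | (r == 1) = k i]))%classic.
  apply/seteqP; split => [w /= <- i _|w kw]; first by rewrite /= ffunE.
  by apply/ffunP => i; rewrite ffunE; apply: kw.
apply: fin_bigcap_measurable => // i _; apply: measurable_funPTI => //.
case: (k i); first by rewrite (_ : [set r | _] = [set 1])%classic //;
  apply/seteqP; split => r /= /eqP.
rewrite (_ : [set r | _] = ~` [set 1])%classic; first exact: measurableC.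
by apply/seteqP; split => r /=; [move/eqP|move/eqP/negbTE].
Qed.

(** A function of [pattern X w] is a finite combination of indicators of the
events [pattern X w = k], and nonnegativity spares any integrability condition.
The case [f = 1] gives the total mass and the case [f k = k i * k j] the
moments. *)
Lemma expectation_pattern {R : realType} {d disp} {T : measurableType disp}
    (P : probability T R) (X : 'I_d -> {RV P >-> R}) (f : binvec d -> R) :
  (forall k, 0 <= f k) ->
  ('E_P[fun w => f (pattern X w)] =
   (\sum_k fine (P [set w | pattern X w = k]%classic) * f k)%:E)%E.
Proof.
move=> f0; set A := fun k : binvec d => [set w | pattern X w = k]%classic.
have mA k : measurable (A k) by exact: measurable_pattern.
rewrite unlock.
transitivity (\int[P]_w \sum_k ((f k)%:E * (\1_(A k) w)%:E))%E.
  apply: eq_integral => w _.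
  rewrite (bigD1 (pattern X w)) //= big1 => [|k kw].
    by rewrite indicE mem_set // mule1 adde0.
  by rewrite indicE memNset ?mule0 // => /esym/eqP; apply/negP.
rewrite ge0_integral_sum //; last 2 first.
- by move=> k; apply/measurable_EFinP/measurable_funM.
- by move=> k x _; rewrite mule_ge0 // lee_fin.
rewrite -sumEFin; apply: eq_bigr => k _.
rewrite ge0_integralZl_EFin //; last exact/measurable_EFinP.
rewrite integral_indic // setIT muleC EFinM fineK //.
exact: fin_num_measure (mA k).
Qed.

Lemma compatible_represents {R : realType} {d} (B : 'M[R]_d) :
  bernoulli_compatible B -> exists p : binvec d -> R, represents p B.
Proof.
case=> disp [T [P [X [X01 XB]]]].
exists (fun k => fine (P [set w | pattern X w = k]%classic)); split.
- by move=> k; rewrite fine_ge0.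
- apply: EFin_inj.
  have /(_ (fun=> ler01)) := expectation_pattern P X (fun=> 1).
  under eq_bigr do rewrite mulr1.
  by move=> <-; rewrite expectation_cst.
- move=> i j; apply: EFin_inj; rewrite -XB.
  rewrite -(expectation_pattern P X (fun k : binvec d => (k i)%:R * (k j)%:R)) //.
  congr ('E_P[ _ ])%E; apply/funext => w; rewrite !ffunE.
  by case: (X01 i w) (X01 j w) => -> [] ->; rewrite ?eqxx // eq_sym oner_eq0.
Qed.

(** * From a law to a random vector *)

(** A copy of the cube that carries the discrete sigma-algebra, for which every
function is measurable. *)
Definition discrete_binvec (d : nat) : Type := binvec d.
HB.instance Definition _ d := Choice.on (discrete_binvec d).
HB.instance Definition _ d := isPointed.Build (discrete_binvec d) [ffun=> false].
HB.instance Definition _ d := @isMeasurable.Build default_measure_display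
  (discrete_binvec d) discrete_measurable discrete_measurable0
  discrete_measurableC discrete_measurableU.

Lemma measurable_discrete {d} {disp} {T : measurableType disp}
  (f : discrete_binvec d -> T) : measurable_fun setT f.
Proof. by []. Qed.

Definition coord {R : realType} {d} (i : 'I_d) (k : discrete_binvec d) : R :=
  (k i)%:R.

HB.instance Definition _ {R : realType} {d} (i : 'I_d) :=
  isMeasurableFun.Build _ _ _ _ (@coord R d i) (measurable_discrete _).

Section discrete_law.
Context {R : realType} {d : nat} (p : binvec d -> R).
Context (p0 : forall k, 0 <= p k).

(** Finite sums of measures are indexed by natural numbers, hence the enumeration
of the cube; the default value is never reached in [discrete_law]. *)
Definition point_mass (n : nat) : {measure set (discrete_binvec d) -> \bar R} :=
  let k := nth [ffun=> false] (binvec_seq d) n in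
  mscale (NngNum (p0 k)) \d_(k : discrete_binvec d).

Definition discrete_law := msum point_mass (size (binvec_seq d)).

Lemma integral_discrete_law (f : discrete_binvec d -> R) :
  (forall k, 0 <= f k) ->
  (\int[discrete_law]_k (f k)%:E = (\sum_k p k * f k)%:E)%E.
Proof.
move=> f0; have mf : measurable_fun setT (EFin \o f) by exact: measurable_discrete.
have f0' k : setT k -> (0 <= (f k)%:E)%E by rewrite lee_fin.
rewrite ge0_integral_measure_sum // -sumEFin.
rewrite -[RHS]big_enum -(perm_big _ (permEl (perm_sort (@binvec_le d) _))) /=.
rewrite (big_nth [ffun=> false]) big_mkord; apply: eq_bigr => n _.
by rewrite ge0_integral_mscale // integral_dirac // diracT mul1e EFinM.
Qed.

Context (p1 : \sum_k p k = 1).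

Lemma discrete_law_setT : discrete_law setT = 1%E.
Proof.
rewrite -[LHS]mul1e -integral_cst //.
rewrite (integral_discrete_law (fun=> 1)) //; congr EFin.
by rewrite -[RHS]p1; apply: eq_bigr => k _; rewrite mulr1.
Qed.

HB.instance Definition _ := Measure.on discrete_law.
HB.instance Definition _ := Measure_isProbability.Build _ _ _ discrete_law
  discrete_law_setT.

Definition discrete_probability : probability (discrete_binvec d) R :=
  discrete_law.

End discrete_law.

Lemma represents_compatible {R : realType} {d} (B : 'M[R]_d) (p : binvec d -> R) :
  represents p B -> bernoulli_compatible B.
Proof.
case=> p0 p1 pB.
exists default_measure_display, (discrete_binvec d), (discrete_probability p p0 p1),
  (fun i => (coord i : {mfun discrete_binvec d >-> R})); split.
  by move=> i k; rewrite /= /coord; case: (k i); [right|left].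
move=> i j; rewrite -pB unlock.
by rewrite (integral_discrete_law p p0 (fun k => (k i)%:R * (k j)%:R)).
Qed.

(** * The linear system as moment equations *)

Lemma all_label_seq d (a : pred (label d)) :
  all a (label_seq d) <->
  [/\ a LOne, forall i, a (LDiag i) & forall i j : 'I_d, (i < j)%N -> a (LOff i j)].
Proof.
rewrite /label_seq /= all_cat all_map; split.
  case/and3P => -> /allP h1 /all_allpairsP h2; split => // [i|i j ij].
    by apply: h1; rewrite mem_enum.
  by apply: h2; [rewrite mem_enum | rewrite mem_filter ij mem_enum].
case=> -> h1 h2; apply/and3P; split=> //; first by apply/allP => i _; apply: h1.
by apply/all_allpairsP => i j _; rewrite mem_filter => /andP[ij _]; apply: h2.
Qed.

(** The rows of the system only involve the entries [B i i] and [B i j] with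
[i < j]: the diagonal rows use [k i] in place of [k i * k i], and symmetry supplies
the entries below the diagonal. *)
Lemma C_mx_p_vec {R : realType} {d} (B : 'M[R]_d) (symB : B^T = B)
    (q : binvec d -> R) (y : 'cV[R]_(2 ^ d)) :
  (forall r, y r 0 = q (tnth (binvec_tuple d) r)) ->
  C_mx R d *m y = p_vec B <->
  \sum_k q k = 1 /\ forall i j, \sum_k q k * ((k i)%:R * (k j)%:R) = B i j.
Proof.
move=> yq.
have sumE (F : binvec d -> R) :
    \sum_(r < 2 ^ d) F (tnth (binvec_tuple d) r) = \sum_k F k.
  rewrite -(big_tuple _ _ (binvec_tuple d) xpredT) /=.
  rewrite -[RHS]big_enum; apply: perm_big; exact: permEl (perm_sort _ _).
(* The row equations as a boolean predicate on labels, so that [all] can range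
   over [label_seq] without comparing labels. *)
pose a l := match l with
  | LOne => \sum_k q k == 1
  | LDiag i => \sum_k q k * (k i)%:R == B i i
  | LOff i j => \sum_k q k * ((k i)%:R * (k j)%:R) == B i j
  end.
have key : C_mx R d *m y = p_vec B <-> all a (label_seq d).
  have rowE r : ((C_mx R d *m y) r 0 == p_vec B r 0) = a (tnth (label_tuple d) r).
    rewrite !mxE; under eq_bigr do rewrite mxE yq.
    rewrite /a; case: (tnth (label_tuple d) r) => [|i|i j];
    rewrite -sumE; congr (_ == _); apply: eq_bigr => k _ ; first by rewrite mul1r.
      by rewrite mulrC.
    by rewrite mulrC.
  split=> [e|/(all_tnthP (t := label_tuple d)) h].
    by apply/(all_tnthP (t := label_tuple d)) => r; rewrite -rowE e.
  by apply/matrixP => r c; rewrite (ord1 c); apply/eqP; rewrite rowE.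
have diagE i : \sum_k q k * ((k i)%:R * (k i)%:R) = \sum_k q k * (k i)%:R.
  by apply: eq_bigr => k _; case: (k i); rewrite ?mulr1 ?mulr0.
rewrite key all_label_seq /=; split.
  case=> /eqP q1 qd qo; split=> // i j.
  have [ij|ji|/val_inj ->] := ltngtP i j.
  - exact/eqP/qo.
  - under eq_bigr do rewrite [_%:R * _]mulrC.
    by rewrite -symB mxE; apply/eqP/qo.
  - by rewrite diagE; apply/eqP.
case=> q1 qB; split=> [|i|i j _]; first exact/eqP.
  by rewrite -diagE qB.
exact/eqP.
Qed.

(** * Averaging a law over the symmetries of the matrix *)

Section group_average.
Context {R : realType} {d : nat} (B : 'M[R]_d).

Definition relabel (k : binvec d) (s : 'S_d) : binvec d := [ffun i => k (s i)].

Lemma relabelK s : cancel (relabel^~ s) (relabel^~ s^-1%g).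
Proof. by move=> k; apply/ffunP => i; rewrite !ffunE permKV. Qed.

Lemma group_set_sym_group : group_set (sym_group B).
Proof.
apply/group_setP; split; first by apply/sym_groupP => i j; rewrite !perm1.
move=> s t /sym_groupP sB /sym_groupP tB; apply/sym_groupP => i j.
by rewrite !permM tB sB.
Qed.

Canonical sym_group_group := group group_set_sym_group.

Definition average (p : binvec d -> R) (k : binvec d) : R :=
  #|sym_group B|%:R^-1 * \sum_(s in sym_group B) p (relabel k s).

Lemma card_sym_group_neq0 : #|sym_group B|%:R != 0 :> R.
Proof. by rewrite pnatr_eq0 -lt0n cardG_gt0. Qed.

(** Replacing [k] by an equivalent vector translates the summation index by an
element of the group. *)
Lemma average_equiv p g h : binvec_equiv B g h -> average p g = average p h.
Proof.
case/existsP => t /andP[tB /eqP ->]; congr (_ * _).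
rewrite [RHS](reindex_inj (mulIg t)) /=.
apply: eq_big => s; first by rewrite groupMr.
by move=> _; congr p; apply/ffunP => i; rewrite !ffunE permM.
Qed.

(** Averaging moves from the law to the function integrated against it, by
substituting [relabel k s^-1] for [k] in the term of [s]. *)
Lemma average_sum p (f : binvec d -> R) :
  \sum_k average p k * f k =
  #|sym_group B|%:R^-1 *
    \sum_(s in sym_group B) \sum_k p k * f (relabel k s^-1%g).
Proof.
under eq_bigr do rewrite -mulrA mulr_suml.
rewrite -mulr_sumr exchange_big /=; congr (_ * _); apply: eq_bigr => s _.
rewrite [RHS](reindex_inj (can_inj (relabelK s))) /=.
by apply: eq_bigr => k _; rewrite relabelK.
Qed.

Lemma average_const c :
  #|sym_group B|%:R^-1 * \sum_(s in sym_group B) c = c :> R.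
Proof.
by rewrite sumr_const -[c *+ _]mulr_natl mulKf // card_sym_group_neq0.
Qed.

(** Each symmetry [s] turns the moment [(i, j)] into the moment of the relabelled
pair, which is the same entry of [B]; so all terms of the average agree. *)
Lemma represents_average p : represents p B -> represents (average p) B.
Proof.
case=> p0 p1 pB; split=> [k||i j].
- by rewrite mulr_ge0 ?invr_ge0 // sumr_ge0.
- under eq_bigr do rewrite -[average _ _]mulr1.
  rewrite (average_sum p (fun=> 1)) -[RHS]average_const; congr (_ * _).
  apply: eq_bigr => s _; rewrite -[RHS]p1.
  by apply: eq_bigr => k _; rewrite mulr1.
- rewrite (average_sum p (fun k => (k i)%:R * (k j)%:R)).
  rewrite -[RHS]average_const; congr (_ * _).
  apply: eq_bigr => s /groupVr/sym_groupP <-; rewrite -pB.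
  by apply: eq_bigr => k _; rewrite !ffunE.
Qed.

End group_average.

(** * Vectors constant on the classes *)

Section classes.
Context {R : realType} {d : nat} (B : 'M[R]_d).

Let eqB : {in [set: binvec d] & &, equivalence_rel (binvec_equiv B)}.
Proof. by move=> g h k _ _ _; apply: binvec_equiv_equivalence. Qed.

(** Every class is nonempty, so the default value is never used. *)
Definition class_rep (c : 'I_(num_classes B)) : binvec d :=
  odflt [ffun=> false] [pick k in (enum_val c : {set binvec d})].

Lemma class_repP c k : k \in (enum_val c : {set binvec d}) ->
  binvec_equiv B k (class_rep c).
Proof.
rewrite /class_rep; case: pickP => [h hc kc /=|e]; last by rewrite e.
have /and3P[_ tI _] := equivalence_partitionP eqB.
rewrite -(pblock_equivalence_partition eqB) ?inE //.
by rewrite (def_pblock tI (enum_valP c) kc).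
Qed.

Lemma class_exists k : exists c : 'I_(num_classes B),
  k \in (enum_val c : {set binvec d}).
Proof.
have /and3P[/eqP cov _ _] := equivalence_partitionP eqB.
have : k \in finset.cover (binvec_classes B) by rewrite cov inE.
case/finset.bigcupP => A AB kA; exists (enum_rank_in AB A).
by rewrite enum_rankK_in.
Qed.

(** The classes are disjoint, so row [r] of [Pi_mx B] has a single 1. *)
Lemma Pi_mxE (x : 'cV[R]_(num_classes B)) (r : 'I_(2 ^ d)) c :
  tnth (binvec_tuple d) r \in (enum_val c : {set binvec d}) ->
  (Pi_mx B *m x) r 0 = x c 0.
Proof.
move=> rc; rewrite mxE (bigD1 c) //= mxE rc mul1r big1 ?addr0 // => e ec.
rewrite mxE; case: (boolP (_ \in _)) => [re|]; last by rewrite mul0r.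
have /and3P[_ /finset.trivIsetP tI _] := equivalence_partitionP eqB.
have := tI _ _ (enum_valP e) (enum_valP c).
rewrite (inj_eq enum_val_inj) => /(_ ec)/pred0P/(_ (tnth (binvec_tuple d) r)).
by rewrite /= re rc.
Qed.

Lemma Pi_mx_class_rep (q : binvec d -> R) r :
  (forall g h, binvec_equiv B g h -> q g = q h) ->
  (Pi_mx B *m \col_c q (class_rep c)) r 0 = q (tnth (binvec_tuple d) r).
Proof.
move=> qB; have [c rc] := class_exists (tnth (binvec_tuple d) r).
by rewrite (Pi_mxE _ _ _ rc) mxE; apply/esym/qB/class_repP.
Qed.

Lemma Pi_mx_ge0 (x : 'cV[R]_(num_classes B)) r :
  (forall c, 0 <= x c 0) -> 0 <= (Pi_mx B *m x) r 0.
Proof.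
by move=> x0; rewrite mxE sumr_ge0 // => c _; rewrite mxE mulr_ge0.
Qed.

End classes.

(** * The equivalence *)

(** Reads a column vector indexed by positions as a function on the cube. *)
Lemma binvec_tuple_index d : exists t : binvec d -> 'I_(2 ^ d),
  cancel (tnth (binvec_tuple d)) t.
Proof.
have tI : injective (tnth (binvec_tuple d)).
  by apply/tuple_uniqP; rewrite /= sort_uniq enum_uniq.
suff [t tK _] : bijective (tnth (binvec_tuple d)) by exists t.
by apply: inj_card_bij => //; rewrite card_ffun card_bool !card_ord.
Qed.

Theorem theorem4p1 (R : realType) (d : nat) (B : 'M[R]_d) (symB : B^T = B) :
  bernoulli_compatible B <->
  exists x : 'cV[R]_(num_classes B),
    (forall c, 0 <= x c 0) /\ C_mx R d *m Pi_mx B *m x = p_vec B.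
Proof.
split.
  move=> /compatible_represents[p /represents_average[q0 q1 qB]].
  exists (\col_c average B p (class_rep B c)); split=> [c|]; first by rewrite mxE.
  rewrite -mulmxA; apply/(C_mx_p_vec B symB (average B p)) => // r.
  exact/Pi_mx_class_rep/average_equiv.
case=> x [x0]; rewrite -mulmxA => Cx.
have [t tK] := binvec_tuple_index d.
apply: (represents_compatible B (fun k => (Pi_mx B *m x) (t k) 0)).
have [|q1 qB] := (C_mx_p_vec B symB (fun k => (Pi_mx B *m x) (t k) 0) _ _).1 Cx.
  by move=> r; rewrite tK.
by split=> // k; apply: Pi_mx_ge0.
Qed.
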